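(* Let $u$ be a bounded viscosity solution to the $(F,\gamma)$-obstacle problem in $\Omega$ with obstacle $\phi\in C^2(\Omega)$ and source term $f\equiv 0$. Suppose further that, for some constant $c$, $$|D\phi|^\gamma F(D^2\phi)\le c<0 \quad\text{in } \Omega.$$ Given $x_0\in\{u>\phi\}\cap\tilde\Omega$ for $\tilde\Omega\subset\subset\Omega$, there exists a universal constant $\mathfrak{c}>0$ such that for $r$ small enough $$\sup_{x\in B_r(x_0)}\left(u(x)-\phi(x)\right)\ge \mathfrak{c}\, r^2.$$
   Context: $\Omega\subset\mathbb{R}^n$ is a smooth, open, bounded domain; $\gamma>0$. $F:\mathrm{Sym}(n)\to\mathbb{R}$ is convex, $F(0)=0$, and uniformly elliptic: for some $0<\lambda\le\Lambda<\infty$ and all symmetric $X,Y$, $\mathcal{M}^-_{\lambda,\Lambda}(X-Y)\le F(X)-F(Y)\le \mathcal{M}^+_{\lambda,\Lambda}(X-Y)$, where, with $e_i$ the eigenvalues of $X$, $\mathcal{M}^-_{\lambda,\Lambda}(X)=\lambda\sum_{e_i>0}e_i+\Lambda\sum_{e_i<0}e_i$ and $\mathcal{M}^+_{\lambda,\Lambda}(X)=\Lambda\sum_{e_i>0}e_i+\lambda\sum_{e_i<0}e_i$. Viscosity solutions: a continuous $u$ is a viscosity supersolution (resp. subsolution) of $|Du|^\gamma F(D^2u)=f$ in an open set if for every $C^2$ function $\varphi$ such that $u-\varphi$ has a strict minimum (resp. strict maximum) at $x_0$, one has $|D\varphi(x_0)|^\gamma F(D^2\varphi(x_0))\le f(x_0)$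 (resp. $\ge f(x_0)$). It is a viscosity solution if it is both. The inequality $|Du|^\gamma F(D^2u)\le f$ in the viscosity sense means $u$ is a supersolution. The $(F,\gamma)$-obstacle problem in $\Omega$ with obstacle $\phi$, source $f$ and boundary datum $g\in C^{1,\beta}(\partial\Omega)$ (some $\beta\in(0,1]$) is: $u\ge\phi$ in $\Omega$; $|Du|^\gamma F(D^2u)\le f$ in $\Omega$; $|Du|^\gamma F(D^2u)=f$ in $\Omega\cap\{u>\phi\}$; $u=g$ on $\partial\Omega$, the differential relations being understood in the viscosity sense. A constant is called universal if it depends only on the given data and not on the solution. *)

(* Defs.v *)
From HB Require Import structures.
From mathcomp Require Import all_boot all_order all_algebra.
From mathcomp Require Import all_classical all_reals all_analysis.
From mathcomp Require Import sesquilinear spectral complex.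
Set Implicit Arguments.
Unset Strict Implicit.
Unset Printing Implicit Defensive.
Import Order.TTheory GRing.Theory Num.Theory.
Import numFieldNormedType.Exports.

Local Open Scope classical_set_scope.
Local Open Scope ring_scope.

Section Euclidean.
Variables (R : realType) (n : nat).
Implicit Types (v x : 'rV[R]_n) (O : set 'rV[R]_n).

(* The library norm on ['rV_n] is the sup norm; it induces the same topology. *)
Definition enorm v : R := Num.sqrt (\sum_i v 0 i ^+ 2).

Definition eball x (r : R) : set 'rV[R]_n := [set y | enorm (y - x) < r].

Definition boundary O : set 'rV[R]_n := closure O `\` interior O.

Definition compactly_contained (O' O : set 'rV[R]_n) : Prop :=
  compact (closure O') /\ closure O' `<=` O.

End Euclidean.

Section Differential.
Variables (R : realType) (n : nat).
Notation E := 'rV[R]_n.+1.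
Implicit Types (O : set E) (f : E -> R).

Definition partial (i : 'I_n.+1) f : E -> R := fun x => 'D_(delta_mx 0 i) f x.

(* [C^k] on an open set, through iterated continuous partial derivatives. *)
Fixpoint Ck (k : nat) O f : Prop :=
  {in O, continuous f} /\
  match k with
  | 0%N => True
  | k'.+1 => forall i : 'I_n.+1,
      (forall x, O x -> derivable f x (delta_mx 0 i)) /\ Ck k' O (partial i f)
  end.

Definition gradient f (x : E) : E := \row_i partial i f x.

Definition hessian f (x : E) : 'M[R]_n.+1 :=
  \matrix_(i, j) partial i (partial j f) x.

Definition smooth_map O (P : E -> E) : Prop :=
  forall (i : 'I_n.+1) (k : nat), Ck k O (fun x => P x 0 i).

End Differential.

Section Domains.
Variables (R : realType) (n : nat).
Notation E := 'rV[R]_n.+1.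
Implicit Types (Om : set E).

(* [P : U -> V] is a smooth diffeomorphism with inverse [Q], defined near [x0],
   that maps [Om] to the half space where the first coordinate is positive. *)
Record boundary_chart Om (x0 : E) (U V : set E) (P Q : E -> E) : Prop := {
  chart_open_source : open U;
  chart_open_target : open V;
  chart_point : U x0;
  chart_fun : forall x, U x -> V (P x) /\ Q (P x) = x;
  chart_inv : forall y, V y -> U (Q y) /\ P (Q y) = y;
  chart_smooth : smooth_map U P;
  chart_inv_smooth : smooth_map V Q;
  chart_domain : forall x, U x -> (Om x <-> 0 < P x 0 ord0);
  chart_boundary : forall x, U x -> (boundary Om x <-> P x 0 ord0 = 0)
}.

Definition smooth_boundary Om : Prop :=
  forall x0, boundary Om x0 ->
    exists (U V : set E) (P Q : E -> E), boundary_chart Om x0 U V P Q.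

Definition smooth_bounded_domain Om : Prop :=
  [/\ open Om, connected Om, Om !=set0, bounded_set Om & smooth_boundary Om].

(* [C^{1,b}] on the boundary: read in a chart, [g] is a function on a relatively
   open part of the hyperplane [y 0 ord0 = 0] whose tangential derivatives are
   Hoelder continuous of exponent [b]. These derivatives only involve the values
   of [g] on the boundary. *)
Definition C1_holder_boundary (b : R) Om (g : E -> R) : Prop :=
  forall x0, boundary Om x0 ->
    exists (U V : set E) (P Q : E -> E),
      boundary_chart Om x0 U V P Q /\
      let H := V `&` [set y : E | y 0 ord0 = 0] in
      forall i : 'I_n.+1, i != ord0 ->
        (forall y, H y -> derivable (g \o Q) y (delta_mx 0 i)) /\
        exists K : R, forall y z, H y -> H z ->
          `|partial i (g \o Q) y - partial i (g \o Q) z|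
            <= K * enorm (y - z) `^ b.

End Domains.

Section Operators.
Variables (R : realType) (n : nat).
Implicit Types (X Y : 'M[R]_n).

Lemma char_poly_sym_splits X : X^T = X ->
  exists s : seq R, char_poly X = \prod_(e <- s) ('X - e%:P).
Proof.
move=> symX.
pose A := map_mx (real_complex R) X.
have Ah : A \is hermsymmx.
  apply/is_hermitianmxP; rewrite expr0 scale1r.
  apply/matrixP => i j; rewrite !mxE -{1}symX mxE.
  by apply/esym/CrealP; rewrite complex_real.
have /orthomx_spectralP/= := hermitian_normalmx Ah.
have dr := hermitian_spectral_diag_real Ah.
set P := spectralmx _; set d := spectral_diag A => eA.
have Pu : P \in unitmx by exact: spectral_unit.
have cA : char_poly A = \prod_(i < n) ('X - (d 0 i)%:P).
  have -> : char_poly A = char_poly (diag_mx d).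
    rewrite /char_poly.
    have -> : char_poly_mx A = map_mx polyC (invmx P) *m char_poly_mx (diag_mx d)
        *m map_mx polyC P.
      rewrite /char_poly_mx mulmxBr mulmxBl -!map_mxM -eA; congr (_ - _).
      by rewrite mul_mx_scalar -scalemxAl -map_mxM mulVmx// map_mx1 scalemx1.
    rewrite !det_mulmx mulrAC -det_mulmx -map_mxM mulVmx// map_mx1 det1.
    by rewrite mul1r.
  rewrite char_poly_trig ?diag_mx_is_trig//.
  by apply: eq_bigr => i _; rewrite mxE eqxx mulr1n.
exists [seq complex.Re (d 0 i) | i <- enum 'I_n].
apply: (@map_poly_inj _ _ (real_complex R)).
rewrite map_char_poly -/A cA big_map rmorph_prod/= big_enum.
apply: eq_bigr => i _; rewrite rmorphB/= map_polyX map_polyC/=.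
congr (_ - _%:P).
by apply/esym/RRe_real; exact: (mxOverP dr).
Qed.

(* The roots of the characteristic polynomial, with multiplicity; the default
   value is never used when [X] is symmetric. *)
Definition eigenvalues X : seq R :=
  xget [::] [set s : seq R | char_poly X = \prod_(e <- s) ('X - e%:P)].

Lemma eigenvaluesP X : X^T = X ->
  char_poly X = \prod_(e <- eigenvalues X) ('X - e%:P).
Proof.
move=> /char_poly_sym_splits[s hs].
exact: (@xgetPex _ [::] [set s : seq R | char_poly X = \prod_(e <- s) ('X - e%:P)]
  (ex_intro _ s hs)).
Qed.

Definition pucci_min (lam Lam : R) X : R :=
  lam * \sum_(e <- eigenvalues X | 0 < e) e +
  Lam * \sum_(e <- eigenvalues X | e < 0) e.

Definition pucci_max (lam Lam : R) X : R :=
  Lam * \sum_(e <- eigenvalues X | 0 < e) e +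
  lam * \sum_(e <- eigenvalues X | e < 0) e.

(* An operator on Sym(n) is encoded as a function on all square matrices whose
   values off the symmetric ones are irrelevant. *)
Definition uniformly_elliptic (lam Lam : R) (F : 'M[R]_n -> R) : Prop :=
  forall X Y, X^T = X -> Y^T = Y ->
    pucci_min lam Lam (X - Y) <= F X - F Y <= pucci_max lam Lam (X - Y).

Definition convex_on_sym (F : 'M[R]_n -> R) : Prop :=
  forall X Y (t : R), X^T = X -> Y^T = Y -> 0 <= t <= 1 ->
    F (t *: X + (1 - t) *: Y) <= t * F X + (1 - t) * F Y.

End Operators.

Section Viscosity.
Variables (R : realType) (n : nat).
Notation E := 'rV[R]_n.+1.
Implicit Types (gamma : R) (F : 'M[R]_n.+1 -> R) (O Om : set E).
Implicit Types (u f phi psi g : E -> R).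

Definition strict_local_min (h : E -> R) (x0 : E) : Prop :=
  \forall x \near x0, x != x0 -> h x0 < h x.

Definition strict_local_max (h : E -> R) (x0 : E) : Prop :=
  \forall x \near x0, x != x0 -> h x < h x0.

Definition operator gamma F psi (x : E) : R :=
  enorm (gradient psi x) `^ gamma * F (hessian psi x).

Definition viscosity_super gamma F O f u : Prop :=
  {within O, continuous u} /\
  forall psi x0, Ck 2 O psi -> O x0 ->
    strict_local_min (fun x => u x - psi x) x0 ->
    operator gamma F psi x0 <= f x0.

Definition viscosity_sub gamma F O f u : Prop :=
  {within O, continuous u} /\
  forall psi x0, Ck 2 O psi -> O x0 ->
    strict_local_max (fun x => u x - psi x) x0 ->
    f x0 <= operator gamma F psi x0.

Definition viscosity_solution gamma F O f u : Prop :=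
  viscosity_super gamma F O f u /\ viscosity_sub gamma F O f u.

Definition noncontact Om phi u : set E := Om `&` [set x | phi x < u x].

Record obstacle_solution gamma F Om phi f g u : Prop := {
  obstacle_continuous : {within closure Om, continuous u};
  obstacle_above : forall x, Om x -> phi x <= u x;
  obstacle_super : viscosity_super gamma F Om f u;
  obstacle_noncontact : viscosity_solution gamma F (noncontact Om phi u) f u;
  obstacle_boundary : forall x, boundary Om x -> u x = g x
}.

End Viscosity.

(* Main.v *)
(* On a compact neighbourhood of [Om'] the derivatives of [phi] up to order two
   are bounded, and [|Dphi|^gamma F(D^2 phi) <= c < 0] then keeps [Dphi] away from
   zero and [F(D^2 phi)] below a negative constant. Hence, for a small universal
   [e], [phi + e |. - x0|^2] is still a strict supersolution, so [u] minus this
   function has no local maximum in the noncontact set. Its maximum over a closed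
   ball about [x0] is positive, as its value at [x0] is, so it is attained at a
   noncontact point, which has to lie on the sphere: there [u - phi >= e s^2]. *)
Require Import Defs.
From mathcomp Require Import all_boot all_order all_algebra.
From mathcomp Require Import all_classical all_reals all_analysis.
From mathcomp Require Import ring lra.
Set Implicit Arguments.
Unset Strict Implicit.
Unset Printing Implicit Defensive.
Import Order.TTheory GRing.Theory Num.Theory.
Import numFieldNormedType.Exports.
Local Open Scope classical_set_scope.
Local Open Scope ring_scope.

(** * Mixed second derivatives and stability of the classes [Ck] on open sets *)

Section Calculus.
Variables (R : realType) (n : nat).
Notation E := 'rV[R]_n.+1.
Implicit Types (O : set E) (f g : E -> R) (x v w : E).

Lemma is_derive_line f x v (t : R) : derivable f (x + t *: v) v ->
  is_derive t 1 (fun s => f (x + s *: v)) ('D_v f (x + t *: v)).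
Proof.
have eqf : (fun h : R => h^-1 *: (((fun s => f (x + s *: v)) \o shift t) (h *: 1)
      - f (x + t *: v))) =
    (fun h => h^-1 *: ((f \o shift (x + t *: v)) (h *: v) - f (x + t *: v))).
  apply/funext => h /=; congr (_ *: (f _ - _)).
  have -> : h *: 1 = h :> R by exact: mulr1.
  by rewrite scalerDl addrCA.
move=> df; apply: DeriveDef; first by rewrite /derivable eqf.
by rewrite /derive eqf.
Qed.

(** Two applications of the mean value theorem: first in direction [v] to the difference of [f]
    along two parallel segments, then in direction [w] to ['D_v f]. *)
Lemma second_difference_mvt f x v w (h : R) : 0 < h ->
  (forall s t, 0 <= s <= h -> 0 <= t <= h ->
    derivable f (x + s *: v + t *: w) v /\
    derivable ('D_v f) (x + s *: v + t *: w) w) ->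
  exists s t, [/\ 0 < s < h, 0 < t < h &
    f (x + h *: v + h *: w) - f (x + h *: v) - f (x + h *: w) + f x =
    'D_w ('D_v f) (x + s *: v + t *: w) * h ^+ 2].
Proof.
move=> h0 df.
(* [G h - G 0] is the second difference in question. *)
pose G s := f (x + h *: w + s *: v) - f (x + s *: v).
have dG s : 0 <= s <= h -> is_derive s 1 G
    ('D_v f (x + h *: w + s *: v) - 'D_v f (x + s *: v)).
  move=> sh; apply: is_deriveB; apply: is_derive_line.
    rewrite addrAC; apply: (df _ _ _ _).1 => //.
    by rewrite lexx ltW.
  rewrite -[x + s *: v]addr0 -(scale0r w); apply: (df _ _ _ _).1 => //.
  by rewrite lexx ltW.
have [s sh Gs] : exists2 s, s \in `]0, h[ & G h - G 0 =
    ('D_v f (x + h *: w + s *: v) - 'D_v f (x + s *: v)) * (h - 0).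
  apply: (@MVT R G (fun s => 'D_v f (x + h *: w + s *: v) - 'D_v f (x + s *: v))).
  - by [].
  - by move=> s; rewrite in_itv/= => /andP[s0 sh]; apply: dG; rewrite !ltW.
  - by apply: derivable_within_continuous => s; rewrite in_itv/= => /dG[].
pose H t := 'D_v f (x + s *: v + t *: w).
move: sh; rewrite in_itv/= => sh.
have s'h : 0 <= s <= h by case/andP: sh => *; rewrite !ltW.
have dH t : 0 <= t <= h -> is_derive t 1 H ('D_w ('D_v f) (x + s *: v + t *: w)).
  by move=> th; apply: is_derive_line; apply: (df _ _ _ _).2.
have [t th Ht] : exists2 t, t \in `]0, h[ & H h - H 0 =
    'D_w ('D_v f) (x + s *: v + t *: w) * (h - 0).
  apply: (@MVT R H (fun t => 'D_w ('D_v f) (x + s *: v + t *: w))).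
  - by [].
  - by move=> t; rewrite in_itv/= => /andP[t0 th]; apply: dH; rewrite !ltW.
  - by apply: derivable_within_continuous => t; rewrite in_itv/= => /dH[].
exists s, t; split=> //.
move: Gs Ht; rewrite /G /H !scale0r !addr0 !subr0 => Gs Ht.
rewrite expr2 mulrA -Ht (addrAC x (s *: v)) -Gs (addrAC x (h *: v)); ring.
Qed.

Lemma near_open O (P : E -> Prop) x : open O -> O x -> (forall y, O y -> P y) ->
  \forall y \near x, P y.
Proof. by move=> oO Ox OP; apply: (filterS OP); apply: open_nbhs_nbhs. Qed.

Lemma near_dist_lt f x (e : R) : {for x, continuous f} -> 0 < e ->
  \forall y \near x, `|f x - f y| < e.
Proof. by move=> cf e0; exact: (@cvgrPdist_lt _ _ _ _ _ _ _).1 cf _ e0. Qed.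

(** The values may coincide at two different points [y] and [z]: this is what the mean value theorem
    provides for the two mixed derivatives. *)
Lemma eq_continuous_at f g x : {for x, continuous f} -> {for x, continuous g} ->
  (forall d : R, 0 < d -> exists y z, [/\ ball x d y, ball x d z & f y = g z]) ->
  f x = g x.
Proof.
move=> cf cg fg; apply/eqP; rewrite -subr_eq0 -normr_le0.
apply/ler_addgt0Pl => e e0; rewrite addr0.
have e20 : 0 < e / 2 by rewrite divr_gt0.
have /nbhs_ballP[d /= d0 dP] := near_dist_lt cf e20.
have /nbhs_ballP[d' /= d'0 d'P] := near_dist_lt cg e20.
have [|y [z [yd zd yz]]] := fg (Num.min d d'); first by rewrite lt_min d0.
have ly : `|f x - f y| < e / 2.
  by apply: dP; apply: le_ball yd; rewrite ge_min lexx.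
have lz : `|g x - g z| < e / 2.
  by apply: d'P; apply: le_ball zd; rewrite ge_min lexx orbT.
rewrite -(subrKA (f y)) (le_trans (ler_normD _ _))// [leRHS]splitr.
by rewrite lerD ?ltW// yz distrC.
Qed.

(** The second difference is symmetric in [v] and [w], so both mixed derivatives take the same value
    at points arbitrarily close to [x]. *)
Lemma schwarz O f x v w : open O -> O x ->
  (forall y, O y -> [/\ derivable f y v, derivable f y w,
    derivable ('D_v f) y w & derivable ('D_w f) y v]) ->
  {for x, continuous ('D_w ('D_v f))} -> {for x, continuous ('D_v ('D_w f))} ->
  'D_w ('D_v f) x = 'D_v ('D_w f) x.
Proof.
move=> oO Ox df c1 c2; apply: eq_continuous_at c1 c2 _ => d' d'0.
have /nbhs_ballP[d'' /= d''0 d''P] : nbhs x O by exact: open_nbhs_nbhs.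
pose d := Num.min d' d''.
have d0 : 0 < d by rewrite lt_min d'0.
pose N := 1 + `|v| + `|w|.
have N0 : 0 < N by rewrite /N -addrA ltr_pwDl// addr_ge0.
(* This keeps the whole parallelogram with sides [h *: v] and [h *: w] in the ball of radius [d];
   the summand 1 in [N] covers [v = w = 0]. *)
pose h := d / 2 / N.
have h0 : 0 < h by rewrite !divr_gt0.
have near_h s t : 0 <= s <= h -> 0 <= t <= h -> ball x d (x + s *: v + t *: w).
  move=> /andP[s0 sh] /andP[t0 th].
  rewrite -ball_normE /ball_/= -addrA opprD addrA subrr sub0r normrN.
  rewrite (le_lt_trans (ler_normD _ _))// !normrZ !ger0_norm//.
  have : h * `|v| + h * `|w| < d.
    rewrite -mulrDr /h.
    have -> : d / 2 / N * (`|v| + `|w|) = d * ((`|v| + `|w|) / N / 2) by ring.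
    rewrite gtr_pMr// ltr_pdivrMr// mul1r.
    rewrite (@lt_trans _ _ 1) ?ltr1n// ltr_pdivrMr// mul1r /N -addrA.
    by rewrite ltrDr.
  by apply: le_lt_trans; rewrite lerD// ler_wpM2r.
have inO s t : 0 <= s <= h -> 0 <= t <= h -> O (x + s *: v + t *: w).
  move=> sh th; apply: d''P; apply: le_ball (near_h _ _ sh th).
  by rewrite ge_min lexx orbT.
have [s1 t1 sh1 th1|s [t [sh th E1]]] := @second_difference_mvt f x v w h h0.
  have [d1 _ d2 _] := df _ (inO s1 t1 sh1 th1); exact: conj.
have [s1 t1 sh1 th1|s' [t' [s'h t'h E2]]] := @second_difference_mvt f x w v h h0.
  rewrite (addrAC x); have [_ d1 _ d2] := df _ (inO t1 s1 th1 sh1).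
  exact: conj d1 d2.
have ltWW (a : R) : 0 < a < h -> 0 <= a <= h by case/andP=> *; rewrite !ltW.
exists (x + s *: v + t *: w), (x + s' *: w + t' *: v); split.
- by apply: le_ball (near_h _ _ _ _); rewrite ?ge_min ?lexx ?ltWW.
- rewrite addrAC.
  by apply: le_ball (near_h _ _ _ _); rewrite ?ge_min ?lexx ?ltWW.
have hn : h ^+ 2 != 0 by rewrite expf_eq0/= gt_eqF.
apply: (mulIf hn); apply: etrans (esym E1) _; apply: etrans _ E2.
by rewrite (addrAC (f _)) (addrAC x).
Qed.

Lemma sub_Ck k O O' f : O' `<=` O -> Ck k O f -> Ck k O' f.
Proof.
move=> O'O; elim: k f => [|k IH] f /= [cf df]; split=> //.
- by move=> x; rewrite inE => /O'O xO; apply: cf; rewrite inE.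
- by move=> x; rewrite inE => /O'O xO; apply: cf; rewrite inE.
- by move=> i; have [dfi /IH] := df i; split=> // x /O'O; apply: dfi.
Qed.

Lemma eq_continuous_open O f g x : open O -> O x -> (forall y, O y -> f y = g y) ->
  {for x, continuous f} -> {for x, continuous g}.
Proof.
move=> oO Ox fg; rewrite /prop_for /continuous_at -fg// => cf.
have gf : g @ x --> f @ x by exact: near_eq_cvg (near_open oO Ox fg).
exact: cvg_trans gf cf.
Qed.

(** Openness lets equality on [O] pass to derivatives. It serves sums, whose partial derivatives are
    known to split only on [O]. *)
Lemma eq_Ck k O f g : open O -> (forall x, O x -> f x = g x) ->
  Ck k O f -> Ck k O g.
Proof.
move=> oO; elim: k f g => [|k IH] f g fg /= [cf df].
  split=> // x xO.
  by apply: eq_continuous_open oO (set_mem xO) fg (cf _ xO).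
split=> [x xO|i].
  by apply: eq_continuous_open oO (set_mem xO) fg (cf _ xO).
have [dfi Ckf] := df i; split=> [x Ox|].
  by apply: near_eq_derivable (dfi _ Ox); apply: near_open oO Ox fg.
apply: IH Ckf => x Ox; apply: near_eq_derive; exact: near_open oO Ox fg.
Qed.

Lemma CkD k O f g : open O -> Ck k O f -> Ck k O g -> Ck k O (f + g).
Proof.
move=> oO; elim: k f g => [|k IH] f g /= [cf df] [cg dg]; split=> //.
- by move=> x xO; apply: continuousD; [apply: cf|apply: cg].
- by move=> x xO; apply: continuousD; [apply: cf|apply: cg].
move=> i; have [dfi Ckf] := df i; have [dgi Ckg] := dg i; split=> [x Ox|].
  by apply: derivableD; [apply: dfi|apply: dgi].
apply: eq_Ck (IH _ _ Ckf Ckg) => // x Ox.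
by rewrite /partial deriveD//; [apply: dfi|apply: dgi].
Qed.

(** Ellipticity of [F] speaks of symmetric matrices only, so it can be applied to a Hessian only
    after this. *)
Lemma hessian_sym O f x : open O -> Ck 2 O f -> O x ->
  (hessian f x)^T = hessian f x.
Proof.
move=> oO [_ df] Ox; apply/matrixP => i j; rewrite !mxE.
have [dfi [_ ddfi]] := df i; have [dfj [_ ddfj]] := df j.
apply: (schwarz oO Ox) => [y Oy||].
- by split; [apply: dfi|apply: dfj|apply: (ddfi j).1|apply: (ddfj i).1].
- by have [_ [+ _]] := ddfi j; apply; rewrite inE.
- by have [_ [+ _]] := ddfj i; apply; rewrite inE.
Qed.

Lemma gradientD O f g x : open O -> O x -> Ck 1 O f -> Ck 1 O g ->
  gradient (f + g) x = gradient f x + gradient g x.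
Proof.
move=> oO Ox [_ df] [_ dg]; apply/rowP => i; rewrite [LHS]mxE [RHS]mxE.
rewrite [X in _ = X + _]mxE [X in _ = _ + X]mxE.
exact: deriveD ((df i).1 _ Ox) ((dg i).1 _ Ox).
Qed.

Lemma hessianD O f g x : open O -> O x -> Ck 2 O f -> Ck 2 O g ->
  hessian (f + g) x = hessian f x + hessian g x.
Proof.
move=> oO Ox [_ df] [_ dg]; apply/matrixP => i j; rewrite [LHS]mxE [RHS]mxE.
rewrite [X in _ = X + _]mxE [X in _ = _ + X]mxE.
have [dfj [_ ddfj]] := df j; have [dgj [_ ddgj]] := dg j.
apply: etrans (deriveD ((ddfj i).1 _ Ox) ((ddgj i).1 _ Ox)).
apply: near_eq_derive; apply: near_open oO Ox _ => y Oy.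
exact: deriveD (dfj _ Oy) (dgj _ Oy).
Qed.

End Calculus.

(** * The Euclidean norm and the derivatives of a paraboloid *)

Section Quadratic.
Variables (R : realType) (n : nat).
Notation E := 'rV[R]_n.+1.
Implicit Types (O : set E) (x a v : E) (e : R).

Definition quadratic e a x : R := e * enorm (x - a) ^+ 2.

Lemma enorm_ge0 x : 0 <= enorm x.
Proof. exact: sqrtr_ge0. Qed.

Lemma enorm_sqr x : enorm x ^+ 2 = \sum_i x 0 i ^+ 2.
Proof. by rewrite sqr_sqrtr// sumr_ge0// => i _; exact: sqr_ge0. Qed.

Lemma enorm0 : enorm (0 : E) = 0.
Proof.
by rewrite /enorm big1 ?sqrtr0// => i _; rewrite mxE expr0n.
Qed.

Lemma enorm_eq0 x : (enorm x == 0) = (x == 0).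
Proof.
apply/idP/eqP => [|->]; last by rewrite enorm0.
rewrite -sqrf_eq0 enorm_sqr psumr_eq0 => [/allP x0|i _]; last exact: sqr_ge0.
apply/rowP => i; rewrite mxE; apply/eqP.
by rewrite -sqrf_eq0; exact: x0 (mem_index_enum i).
Qed.

Lemma enormN x : enorm (- x) = enorm x.
Proof. by congr Num.sqrt; apply: eq_bigr => i _; rewrite mxE sqrrN. Qed.

Lemma enormZ e x : 0 <= e -> enorm (e *: x) = e * enorm x.
Proof.
move=> e0; rewrite /enorm.
under eq_bigr do rewrite mxE exprMn.
by rewrite -mulr_sumr sqrtrM ?sqr_ge0// sqrtr_sqr ger0_norm.
Qed.

Lemma coord_le_enorm x i : `|x 0 i| <= enorm x.
Proof.
rewrite -[leLHS]sqrtr_sqr ler_sqrt; last first.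
  by apply: sumr_ge0 => j _; exact: sqr_ge0.
by rewrite (bigD1 i)//= lerDl sumr_ge0// => j _; exact: sqr_ge0.
Qed.

(** Passes from Euclidean balls to the sup-norm balls of the library topology. *)
Lemma norm_le_enorm x : `|x| <= enorm x.
Proof.
rewrite [`|x|]mx_normrE; apply/bigmax_leP; split=> [|[i j] _].
  exact: enorm_ge0.
by rewrite (ord1 i); exact: coord_le_enorm.
Qed.

Lemma enorm_le (M : R) x : (forall i, `|x 0 i| <= M) -> enorm x <= M * n.+1%:R.
Proof.
move=> xM; have M0 : 0 <= M by exact: le_trans (xM ord0).
rewrite -(ler_pXn2r (ltn0Sn 1)) ?nnegrE ?enorm_ge0 ?mulr_ge0// enorm_sqr.
apply: le_trans (_ : \sum_(i < n.+1) M ^+ 2 <= _).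
  apply: ler_sum => i _; rewrite -real_normK ?num_real//.
  by rewrite ler_pXn2r// ?nnegrE.
rewrite sumr_const card_ord -[leLHS]mulr_natr exprMn ler_wpM2l ?sqr_ge0//.
by rewrite expr2 ler_peMr// ler1n.
Qed.

Lemma is_derive_coord x v i : is_derive x v (fun y : E => y 0 i) (v 0 i).
Proof.
pose q (h : R) := h^-1 *: (((fun y : E => y 0 i) \o shift x) (h *: v) - x 0 i).
(* A coordinate is linear, so its difference quotient is constant away from 0. *)
have qE : \forall h \near 0^', v 0 i = q h.
  near=> h; rewrite /q /= !mxE addrK [RHS]mulrA mulVf ?mul1r//.
  by near: h; exact: nbhs_dnbhs_neq.
have c : q h @[h --> 0^'] --> v 0 i.
  have gf : q h @[h --> 0^'] --> (fun=> v 0 i) @ (0^' : set_system R).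
    exact: near_eq_cvg qE.
  exact: cvg_trans gf (cvg_cst _).
split; first exact: cvgP c.
exact: cvg_lim c.
Unshelve. all: by end_near. Qed.

Lemma is_derive_quadratic e a x v :
  is_derive x v (quadratic e a) (2 * e * \sum_i (x 0 i - a 0 i) * v 0 i).
Proof.
have -> : quadratic e a =
    e \*: (\sum_(i < n.+1) (fun y : E => y 0 i - a 0 i) ^+ 2).
  apply/funext => y; rewrite /quadratic enorm_sqr fct_sumE /=.
  by congr (e * _); apply: eq_bigr => i _; rewrite !mxE.
have d i : is_derive x v (fun y : E => y 0 i - a 0 i) (v 0 i).
  rewrite -[v 0 i]subr0; apply: is_deriveB; exact: is_derive_coord.
apply: is_derive_eq.
rewrite /GRing.scale/= -mulrA mulrCA; congr (e * _); rewrite mulr_sumr.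
by apply: eq_bigr => i _; rewrite expr1 mulrA.
Qed.

Lemma partial_quadratic i e a :
  partial i (quadratic e a) = fun x => 2 * e * (x 0 i - a 0 i).
Proof.
apply/funext => x; rewrite /partial.
rewrite (@derive_val _ _ _ _ _ _ _ (is_derive_quadratic _ _ _ _)).
congr (_ * _); rewrite (bigD1 i)//= big1 ?addr0 => [|j ji]; rewrite !mxE/=.
  by rewrite eqxx mulr1.
by rewrite (negbTE ji) mulr0.
Qed.

Lemma is_derive_partial_quadratic i e a x v :
  is_derive x v (partial i (quadratic e a)) (2 * e * v 0 i).
Proof.
rewrite partial_quadratic.
have d : is_derive x v (fun y : E => y 0 i - a 0 i) (v 0 i).
  rewrite -[v 0 i]subr0; apply: is_deriveB; exact: is_derive_coord.
have -> : (fun x0 : E => 2 * e * (x0 0 i - a 0 i)) =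
  (2 * e) \*: (fun y : E => y 0 i - a 0 i) by [].
exact: is_derive_eq.
Qed.

Lemma partial_partial_quadratic i j e a :
  partial i (partial j (quadratic e a)) = fun x => 2 * e * (i == j)%:R.
Proof.
apply/funext => x.
rewrite {1}/partial.
rewrite (@derive_val _ _ _ _ _ _ _ (is_derive_partial_quadratic _ _ _ _ _)) mxE.
by rewrite eqxx eq_sym.
Qed.

Lemma gradient_quadratic e a x : gradient (quadratic e a) x = (2 * e) *: (x - a).
Proof. by apply/rowP => i; rewrite !mxE partial_quadratic. Qed.

Lemma hessian_quadratic e a x : hessian (quadratic e a) x = (2 * e)%:M.
Proof.
by apply/matrixP => i j; rewrite !mxE partial_partial_quadratic mulr_natr.
Qed.

Lemma continuous_sub_coord a i : continuous (fun y : E => y 0 i - a 0 i).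
Proof.
by move=> x; apply: continuousB; [exact: coord_continuous|exact: cst_continuous].
Qed.

Lemma continuous_quadratic e a : continuous (quadratic e a).
Proof.
have -> : quadratic e a =
    fun x => e * \sum_i (x 0 i - a 0 i) * (x 0 i - a 0 i).
  apply/funext => y; rewrite /quadratic enorm_sqr.
  by congr (e * _); apply: eq_bigr => i _; rewrite !mxE expr2.
have c i : continuous (fun x : E => (x 0 i - a 0 i) * (x 0 i - a 0 i)).
  pose f (x : E) := x 0 i - a 0 i.
  by move=> x; apply: (@continuousM R E f f); exact: continuous_sub_coord.
pose g (x : E) := \sum_i (x 0 i - a 0 i) * (x 0 i - a 0 i).
move=> x; apply: (@continuousM R E (fun=> e) g); first exact: cst_continuous.
by apply: (@continuous_big _ _ +%R); [exact: add_continuous|move=> i _; exact: c].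
Qed.

Lemma Ck2_quadratic O e a : Ck 2 O (quadratic e a).
Proof.
split=> [x _|i]; first exact: continuous_quadratic.
split=> [x _|]; first by case: (is_derive_quadratic e a x (delta_mx 0 i)).
split=> [x _|j].
  rewrite partial_quadratic.
  apply: (@continuousM R E (fun=> 2 * e) (fun y : E => y 0 i - a 0 i)).
    exact: cst_continuous.
  exact: continuous_sub_coord.
split=> [x _|].
  by case: (is_derive_partial_quadratic i e a x (delta_mx 0 j)).
by split=> // x _; rewrite partial_partial_quadratic; exact: cst_continuous.
Qed.

End Quadratic.

(** * Eigenvalue bounds and their consequences for elliptic operators *)

Section Eigenvalues.
Variables (R : realType) (n : nat).
Implicit Types (X : 'M[R]_n.+1) (lam Lam M a e : R).

Lemma size_eigenvalues X : X^T = X -> size (eigenvalues X) = n.+1.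
Proof.
by move=> /eigenvaluesP/(congr1 (fun p : {poly R} => size p));
  rewrite size_char_poly size_prod_XsubC => -[].
Qed.

Lemma mem_eigenvalues X e : X^T = X -> (e \in eigenvalues X) = eigenvalue X e.
Proof.
move=> /eigenvaluesP h.
by rewrite eigenvalue_root_char h root_prod_XsubC.
Qed.

Lemma sum_constant_seq (s : seq R) a : \sum_(e <- s) a = a *+ size s.
Proof. by rewrite big_const_seq count_predT iter_addr_0. Qed.

Lemma eigenvalue_le X M e : (forall i j, `|X i j| <= M) -> eigenvalue X e ->
  `|e| <= M *+ n.+1.
Proof.
move=> XM /eigenvalueP[v vX v0].
(* At a coordinate of largest modulus of the row eigenvector, the equation [v *m X = e *: v] bounds
   [e] by a sum of [n.+1] entries of [X]. *)
pose j := [arg max_(j > ord0) `|v 0 j|]%O.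
have vj i : `|v 0 i| <= `|v 0 j|.
  by rewrite /j; case: arg_maxP => // k _; exact.
have vj0 : 0 < `|v 0 j|.
  rewrite lt_neqAle normr_ge0 andbT eq_sym; apply: contra v0 => /eqP v0.
  apply/eqP/rowP => i; rewrite mxE; apply/eqP; rewrite -normr_le0.
  by rewrite -v0.
rewrite -(ler_pM2r vj0) -normrM.
have -> : e * v 0 j = \sum_i v 0 i * X i j.
  by have /rowP/(_ j) := vX; rewrite !mxE.
rewrite (le_trans (ler_norm_sum _ _ _))//.
apply: le_trans (_ : \sum_(i < n.+1) M * `|v 0 j| <= _); last first.
  by rewrite sumr_const card_ord mulrnAl.
rewrite ler_sum// => i _.
by rewrite normrM mulrC ler_pM.
Qed.

(** Compare [X] with 0 and drop the positive eigenvalues. One factor [n.+1] counts eigenvalues, the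
    other comes from bounding each by the entries. *)
Lemma uniformly_elliptic_ge lam Lam (F : 'M[R]_n.+1 -> R) X M :
  0 < lam -> lam <= Lam -> uniformly_elliptic lam Lam F -> F 0 = 0 ->
  X^T = X -> (forall i j, `|X i j| <= M) ->
  - (Lam * (M *+ n.+1 *+ n.+1)) <= F X.
Proof.
move=> lam0 lamLam FE F0 Xs XM.
have /andP[+ _] := FE X 0 Xs (trmx0 _ _ _).
rewrite !subr0 F0 subr0; apply: le_trans.
have Lam0 : 0 <= Lam by exact: le_trans (ltW lam0) lamLam.
have p0 : 0 <= lam * \sum_(e <- eigenvalues X | 0 < e) e.
  by apply: mulr_ge0; [exact: ltW|apply: sumr_ge0 => e /ltW].
rewrite /pucci_min -mulrN.
apply: le_trans (_ : _ <= Lam * \sum_(e <- eigenvalues X | e < 0) e) _;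
  last by rewrite lerDr.
rewrite ler_wpM2l//.
rewrite -{2}(size_eigenvalues Xs) -mulNrn -sum_constant_seq.
rewrite [leRHS]big_mkcond big_seq [leRHS]big_seq; apply: ler_sum => e.
rewrite mem_eigenvalues// => /(eigenvalue_le XM) eM.
have M0 : 0 <= M *+ n.+1 by exact: le_trans eM.
case: ifP => _; last by rewrite oppr_le0.
by rewrite lerNl (le_trans _ eM)// -normrN ler_norm.
Qed.

Lemma pucci_max_scalar lam Lam a : 0 < a ->
  pucci_max lam Lam (a%:M : 'M[R]_n.+1) = Lam * (a *+ n.+1).
Proof.
move=> a0; have sa := tr_scalar_mx n.+1 a.
have ea e : e \in eigenvalues (a%:M : 'M[R]_n.+1) -> e = a.
  rewrite mem_eigenvalues// => /eigenvalueP[v].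
  rewrite mul_mx_scalar => /eqP; rewrite -subr_eq0 -scalerBl scaler_eq0.
  by case/orP => [|->//]; rewrite subr_eq0 => /eqP.
rewrite /pucci_max big_seq_cond [X in _ + _ * X]big_seq_cond.
rewrite [X in _ + _ * X]big1 => [|e /andP[/ea ->]]; last by rewrite ltNge ltW.
rewrite mulr0 addr0; congr (_ * _).
transitivity (\sum_(e <- eigenvalues (a%:M : 'M[R]_n.+1)) a); last first.
  by rewrite sum_constant_seq size_eigenvalues.
(* Every eigenvalue equals [a > 0], so the filter [0 < e] removes nothing. *)
rewrite [RHS]big_seq_cond; apply: eq_big => [e|e /andP[/ea]//].
by case: (boolP (e \in _)) => //= /ea ->; rewrite a0.
Qed.

Lemma uniformly_elliptic_scalar_le lam Lam (F : 'M[R]_n.+1 -> R) X a :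
  uniformly_elliptic lam Lam F -> X^T = X -> 0 < a ->
  F (X + a%:M) <= F X + Lam * (a *+ n.+1).
Proof.
move=> FE Xs a0; rewrite -lerBlDl -(pucci_max_scalar lam)//.
have Ys : (X + a%:M)^T = X + a%:M by rewrite linearD/= Xs tr_scalar_mx.
by have /andP[_] := FE _ _ Ys Xs; rewrite [X in pucci_max _ _ X]addrC addKr.
Qed.

End Eigenvalues.

(** * Uniform bounds near a compact subset of an open set *)

Section InteriorBounds.
Variables (R : realType) (n : nat).
Notation E := 'rV[R]_n.+1.
Implicit Types (O K : set E) (f : E -> R).

(** A single [d] measures both the margin around [K] and, through [d^-1], the bound on [f]. Both
    requirements weaken as [d] decreases, so local choices combine over the compact set. *)
Lemma compact_uniform_bound O K f : open O -> compact K -> K `<=` O ->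
  {in O, continuous f} ->
  \forall d \near 0^'+, forall z, K z -> forall y, `|y - z| <= d ->
    O y /\ `|f y| <= d^-1.
Proof.
move=> oO cK KO cf.
apply: ((compact_near_coveringP K).1 cK R (0^'+)
  (fun d z => forall y, `|y - z| <= d -> O y /\ `|f y| <= d^-1)) => x Kx.
have Ox := KO _ Kx.
have /nbhs_ballP[e /= e0 eO] : nbhs x O by exact: open_nbhs_nbhs.
have /nbhs_ballP[e' /= e'0 e'P] := near_dist_lt (cf x (mem_set Ox)) ltr01.
(* The half leaves room for two moves: from [x] to [z], then from [z] to [y]. *)
pose a := Num.min e e' / 2.
have a0 : 0 < a by rewrite divr_gt0// lt_min e0.
pose b := (`|f x| + 1)^-1.
have b0 : 0 < b by rewrite invr_gt0 ltr_wpDl.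
near=> z d => y yz.
have d0 : 0 < d by near: d; exact: nbhs_right_gt.
have da : d < a by near: d; exact: nbhs_right_lt.
have db : d <= b by near: d; exact: nbhs_right_le.
have xz : ball x a z by near: z; exact: nbhsx_ballx.
have xy : ball x (Num.min e e') y.
  rewrite [Num.min _ _]splitr; apply: ball_triangle xz _.
  by rewrite -ball_normE /ball_/= distrC (le_lt_trans yz).
split; first by apply: eO; apply: le_ball xy; rewrite ge_min lexx.
have fxy : `|f x - f y| < 1.
  by apply: e'P; apply: le_ball xy; rewrite ge_min lexx orbT.
apply: le_trans (_ : `|f x| + 1 <= _); last first.
  by rewrite -[leLHS]invrK lef_pV2.
rewrite -lerBlDl (le_trans _ (ltW fxy))// distrC.
by rewrite (le_trans (lerB_dist _ _)).
Unshelve. all: by end_near. Qed.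

(** The finitely many bounds, for [f] and its derivatives, each hold for all small [d], hence for a
    common one. *)
Lemma Ck2_compact_bound O K f : open O -> compact K -> K `<=` O -> Ck 2 O f ->
  exists2 d : R, 0 < d & forall z, K z -> forall y, `|y - z| <= d ->
    [/\ O y, `|f y| <= d^-1, forall i, `|gradient f y 0 i| <= d^-1 &
        forall i j, `|hessian f y i j| <= d^-1].
Proof.
move=> oO cK KO [cf df].
pose P (g : E -> R) (d : R) := forall z, K z -> forall y, `|y - z| <= d ->
  O y /\ `|g y| <= d^-1.
have : \forall d \near 0^'+, [/\ 0 < d, P f d, forall i, P (partial i f) d &
    forall i j, P (partial i (partial j f)) d].
  have h1 : \forall d \near 0^'+, P f d by exact: compact_uniform_bound.
  have h2 : \forall d \near 0^'+, forall i, P (partial i f) d.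
    apply: filter_forall => i; apply: compact_uniform_bound => //.
    exact: (df i).2.1.
  have h3 : \forall d \near 0^'+, forall i j, P (partial i (partial j f)) d.
    apply: filter_forall => i; apply: filter_forall => j.
    apply: compact_uniform_bound => //.
    exact: ((df j).2.2 i).2.1.
  near=> d; split; near: d; [exact: nbhs_right_gt|exact: h1|exact: h2|exact: h3].
move=> /filter_ex[d [d0 p0 p1 p2]]; exists d => // z Kz y yz.
have [Oy fy] := p0 _ Kz _ yz.
split=> // [i|i j]; rewrite mxE; first by have [] := p1 i _ Kz _ yz.
by have [] := p2 i j _ Kz _ yz.
Unshelve. all: by end_near. Qed.

End InteriorBounds.

(** * Stability of strict supersolutions of the degenerate operator *)

Section Degeneracy.
Variables (R : realType) (n : nat).
Notation E := 'rV[R]_n.+1.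
Implicit Types (p : E) (X : 'M[R]_n.+1) (F : 'M[R]_n.+1 -> R).

(* The degenerate operator can only be negative where the gradient is away from
   zero: a lower bound on [F X] bounds [p] from below, and then an upper bound
   on [p] makes [F X] itself uniformly negative. Both survive a perturbation of
   size [e]. *)
Lemma supersolution_perturbation lam Lam (gamma c d : R) F :
  0 < lam -> lam <= Lam -> uniformly_elliptic lam Lam F -> F 0 = 0 ->
  0 < gamma -> c < 0 -> 0 < d ->
  exists2 e : R, 0 < e & forall p X v, X^T = X ->
    (forall i, `|p 0 i| <= d^-1) -> (forall i j, `|X i j| <= d^-1) ->
    enorm p `^ gamma * F X <= c -> enorm v <= d ->
    enorm (p + (2 * e) *: v) `^ gamma * F (X + (4 * e)%:M) < 0.
Proof.
move=> lam0 lamLam FE F0 g0 c0 d0.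
have Lam0 : 0 < Lam by exact: lt_le_trans lam0 lamLam.
have M0 : 0 < d^-1 by rewrite invr_gt0.
pose B := Lam * (d^-1 *+ n.+1 *+ n.+1).
have B0 : 0 < B by rewrite mulr_gt0// !pmulrn_lgt0.
pose L := (d^-1 * n.+1%:R) `^ gamma.
have L0 : 0 < L by rewrite powR_gt0// mulr_gt0.
(* Since [- B <= F X], having the operator at most [c] forces [q <= enorm p]. *)
pose q := (- c / B) `^ gamma^-1.
have cB0 : 0 < - c / B by rewrite divr_gt0// oppr_gt0.
have q0 : 0 < q by rewrite powR_gt0.
have qg : q `^ gamma = - c / B by rewrite -powRrM mulVf ?gt_eqF// powRr1// ltW.
pose LN := Lam * n.+1%:R.
have LN0 : 0 < LN by rewrite mulr_gt0.
(* The first entry keeps the change of gradient below [q / 2]; the second keeps the increase of [F]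
   below half of [- c / L]. *)
pose e := Num.min (q / (4 * d)) (- c / L / (8 * LN)).
have e0 : 0 < e by rewrite lt_min !divr_gt0 ?oppr_gt0// mulr_gt0.
exists e => // p X v Xs pM XM pX vd.
have Xge : - B <= F X := uniformly_elliptic_ge lam0 lamLam FE F0 Xs XM.
have pg0 : 0 <= enorm p `^ gamma by exact: powR_ge0.
have pge : q <= enorm p.
  rewrite leNgt; apply/negP => pq.
  have : enorm p `^ gamma < - c / B.
    by rewrite -qg gt0_ltr_powR// nnegrE ?enorm_ge0// ltW.
  rewrite ltr_pdivlMr// => h.
  have := ler_wpM2l pg0 Xge; rewrite mulrN => h'.
  by have := le_trans h' pX; rewrite lerNl leNgt h.
have pL : enorm p `^ gamma <= L.
  apply: ge0_ler_powR; rewrite ?nnegrE ?enorm_ge0//; [exact: ltW| |].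
    by rewrite ltW// mulr_gt0.
  exact: enorm_le.
(* The sign of [F X] comes first: replacing the gradient factor by its upper bound [L] lowers the
   product only when [F X <= 0]. *)
have FXle : F X <= c / L.
  have FX0 : F X <= 0.
    rewrite leNgt; apply/negP => FX0.
    by have := le_lt_trans pX c0; rewrite ltNge mulr_ge0// ltW.
  rewrite ler_pdivlMr// (le_trans _ pX)// mulrC -lerN2 -!mulrN.
  by rewrite ler_wpM2r// oppr_ge0.
have Fneg : F (X + (4 * e)%:M) < 0.
  have e4 : 0 < 4 * e by rewrite mulr_gt0.
  apply: le_lt_trans (uniformly_elliptic_scalar_le FE Xs e4) _.
  have : e <= - c / L / (8 * LN) by rewrite ge_min lexx orbT.
  rewrite ler_pdivlMr ?mulr_gt0// => he.
  have -> : Lam * (4 * e *+ n.+1) = 4 * (LN * e).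
    by rewrite /LN -mulr_natr; ring.
  have cL : c / L < 0 by rewrite pmulr_llt0// invr_gt0.
  move: he; rewrite !mulNr; lra.
(* The gradient must not vanish, or the product would be 0. If it did, [enorm p] would be at most
   [q / 2], against [q <= enorm p]. *)
rewrite pmulr_rlt0// powR_gt0// lt_neqAle enorm_ge0 andbT eq_sym enorm_eq0.
apply/negP; rewrite addr_eq0 => /eqP pE.
have e2 : 0 <= 2 * e by rewrite mulr_ge0// ltW.
have : enorm p <= q / 2.
  rewrite pE enormN enormZ//; apply: le_trans (ler_wpM2l e2 vd) _.
  have : e <= q / (4 * d) by rewrite ge_min lexx.
  rewrite ler_pdivlMr ?mulr_gt0//; lra.
move=> /(le_trans pge); lra.
Qed.

End Degeneracy.

(** * Euclidean balls in the topology of the sup norm *)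

Section Balls.
Variables (R : realType) (n : nat).
Notation E := 'rV[R]_n.+1.

Lemma closed_eball_compact (x : E) (s : R) : compact [set y | enorm (y - x) <= s].
Proof.
apply: bounded_closed_compact.
  exists (`|x| + s); split; first exact: num_real.
  move=> M /ltW xsM y /= ys; rewrite (le_trans _ xsM)//.
  rewrite -(subrK x y) (le_trans (ler_normD _ _))// addrC lerD2l.
  by rewrite (le_trans (norm_le_enorm _)).
(* Describing the ball through the squared norm requires [0 <= s]; for negative [s] it is empty. *)
have [s0|s0] := leP 0 s; last first.
  rewrite (_ : mkset _ = set0); first exact: closed0.
  rewrite -subset0 => y /=; rewrite leNgt; apply/negP/negPn.
  by rewrite (lt_le_trans s0) ?enorm_ge0.
rewrite (_ : mkset _ = quadratic 1 x @^-1` [set t | t <= s ^+ 2]).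
  apply: preimage_closed; first by move=> y _; exact: continuous_quadratic.
  exact: closed_le.
apply/seteqP; split=> y /=; rewrite /quadratic mul1r ler_pXn2r ?nnegrE ?enorm_ge0//.
Qed.

Lemma eball_nbhs (x y : E) (s : R) : enorm (y - x) < s ->
  \forall z \near y, enorm (z - x) < s.
Proof.
move=> ys; have s0 : 0 < s by exact: le_lt_trans (enorm_ge0 _) ys.
have ys2 : quadratic 1 x y < s ^+ 2.
  by rewrite /quadratic mul1r ltr_pXn2r ?nnegrE ?enorm_ge0// ltW.
have cq : quadratic 1 x z @[z --> y] --> quadratic 1 x y.
  exact: continuous_quadratic.
apply: filterS (cvgr_lt _ cq _ ys2) => z.
rewrite /quadratic mul1r ltr_pXn2r ?nnegrE ?enorm_ge0//.
exact: ltW.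
Qed.

End Balls.

(** * Quadratic growth by comparison with paraboloids *)

Section Growth.
Variables (R : realType) (n : nat).
Notation E := 'rV[R]_n.+1.
Implicit Types (Om : set E) (u phi : E -> R) (x y : E).

Definition paraboloid_test phi (e : R) x y : E -> R :=
  phi + quadratic e x + quadratic e y.

Lemma Ck2_paraboloid_test Om phi (e : R) x y : open Om -> Ck 2 Om phi ->
  Ck 2 Om (paraboloid_test phi e x y).
Proof.
move=> oO Cphi.
exact: CkD oO (CkD oO Cphi (Ck2_quadratic _ _ _)) (Ck2_quadratic _ _ _).
Qed.

(** At its own vertex [y] the second paraboloid adds nothing to the gradient but still adds [2 * e]
    to the Hessian, whence [4 * e]. *)
Lemma operator_paraboloid_test gamma (F : 'M[R]_n.+1 -> R) Om phi (e : R) x y :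
  open Om -> Ck 2 Om phi -> Om y ->
  operator gamma F (paraboloid_test phi e x y) y =
  enorm (gradient phi y + (2 * e) *: (y - x)) `^ gamma *
  F (hessian phi y + (4 * e)%:M).
Proof.
move=> oO Cphi Oy; have Cx := Ck2_quadratic Om e x; have Cy := Ck2_quadratic Om e y.
have C1 g : Ck 2 Om g -> Ck 1 Om g.
  by move=> [cg dg]; split=> // i; have [dgi [cgi _]] := dg i.
rewrite /operator /paraboloid_test.
rewrite (gradientD oO Oy (C1 _ (CkD oO Cphi Cx)) (C1 _ Cy)).
rewrite (gradientD oO Oy (C1 _ Cphi) (C1 _ Cx)) !gradient_quadratic.
rewrite (hessianD oO Oy (CkD oO Cphi Cx) Cy) (hessianD oO Oy Cphi Cx).
rewrite !hessian_quadratic subrr scaler0 addr0 -addrA -raddfD/=.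
by have -> : 2 * e + 2 * e = 4 * e by ring.
Qed.

(* At an interior maximum point [y] the second paraboloid, whose gradient
   vanishes at [y], only makes the maximum strict. *)
Lemma quadratic_growth gamma F Om phi u (e s : R) x :
  open Om -> Ck 2 Om phi -> {in Om, continuous u} ->
  viscosity_sub gamma F (noncontact Om phi u) (fun=> 0) u ->
  noncontact Om phi u x -> 0 < e -> 0 < s ->
  (forall y, enorm (y - x) <= s -> Om y /\
    enorm (gradient phi y + (2 * e) *: (y - x)) `^ gamma *
    F (hessian phi y + (4 * e)%:M) < 0) ->
  exists2 y, enorm (y - x) <= s & e * s ^+ 2 <= u y - phi y.
Proof.
move=> oO Cphi cu [_ usub] [Ox phiux] e0 s0 neg.
pose w y := u y - phi y - quadratic e x y.
pose K := [set y : E | enorm (y - x) <= s].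
have Kx : K x by rewrite /K/= subrr enorm0 ltW.
have cw : {within K, continuous w}.
  apply: continuous_in_subspaceT => y /set_mem Ky.
  have [Oy _] := neg _ Ky.
  have cup : {for y, continuous (fun z => u z - phi z)}.
    exact: (@continuousB _ _ _ u phi y (cu y (mem_set Oy)) (Cphi.1 y (mem_set Oy))).
  exact: (@continuousB _ _ _ _ _ y cup (@continuous_quadratic _ _ e x y)).
have [y /set_mem Ky yw] :=
  compact_EVT_max (ex_intro _ x Kx) (@closed_eball_compact R n x s) cw.
have wy : 0 < w y.
  apply: lt_le_trans (yw x (mem_set Kx)).
  by rewrite /w /quadratic subrr enorm0 expr0n mulr0 subr0 subr_gt0.
have qy : e * enorm (y - x) ^+ 2 < u y - phi y by rewrite -subr_gt0.
have [Oy opneg] := neg _ Ky.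
have Ny : noncontact Om phi u y.
  split=> //=; rewrite -subr_gt0; apply: le_lt_trans qy.
  by rewrite mulr_ge0 ?sqr_ge0// ltW.
(* On the sphere the bound is immediate from [qy]; an interior maximum is refuted by the subsolution
   property. *)
exists y => //; have [ys|sy] := ltP (enorm (y - x)) s; last first.
  apply: le_trans (ltW qy); rewrite ler_pM2l//.
  by rewrite ler_pXn2r// ?nnegrE ?enorm_ge0 ?ltW.
have Cpsi : Ck 2 (noncontact Om phi u) (paraboloid_test phi e x y).
  by apply: sub_Ck (Ck2_paraboloid_test e x y oO Cphi) => z [].
have smax : strict_local_max (fun z => u z - paraboloid_test phi e x y z) y.
  apply: filterS (eball_nbhs ys) => z zs zy.
  have := yw z (mem_set (ltW zs)); rewrite /w /paraboloid_test !fctE => wz.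
  have q0 : quadratic e y y = 0.
    by rewrite /quadratic subrr enorm0 expr0n mulr0.
  have qz : 0 < quadratic e y z.
    rewrite mulr_gt0// exprn_gt0// lt_neqAle enorm_ge0 andbT eq_sym.
    by rewrite enorm_eq0 subr_eq0.
  lra.
have := usub _ _ Cpsi Ny smax.
by rewrite (operator_paraboloid_test _ _ _ _ oO)// leNgt opneg.
Qed.

End Growth.

(** * Uniform constants and passage to the supremum over an open ball *)

Theorem theorem1p9 (R : realType) (n : nat) (lam Lam gamma beta c : R)
    (F : 'M[R]_n.+1 -> R) (Om Om' : set 'rV[R]_n.+1)
    (phi g : 'rV[R]_n.+1 -> R)
    (hOm : smooth_bounded_domain Om)
    (hgamma : 0 < gamma)
    (hlam : 0 < lam) (hLam : lam <= Lam)
    (hFconvex : convex_on_sym F) (hF0 : F 0 = 0)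
    (hFelliptic : uniformly_elliptic lam Lam F)
    (hphi : Ck 2 Om phi)
    (hbeta : 0 < beta <= 1) (hg : C1_holder_boundary beta Om g)
    (hc : c < 0)
    (hobstacle : forall x, Om x -> operator gamma F phi x <= c)
    (hOm' : compactly_contained Om' Om) :
  exists2 C : R, 0 < C &
  exists2 r0 : R, 0 < r0 &
  forall u : 'rV[R]_n.+1 -> R,
    [bounded u x | x in closure Om] ->
    obstacle_solution gamma F Om phi (fun=> 0) g u ->
    forall x0, (noncontact Om phi u `&` Om') x0 ->
    forall r : R, 0 < r < r0 ->
      C * r ^+ 2 <= sup [set u x - phi x | x in eball x0 r].
Proof.
have oO : open Om by case: hOm.
have [cOm' sOm'] := hOm'.
have [d d0 dP] := Ck2_compact_bound oO cOm' sOm' hphi.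
have [e e0 eP] := supersolution_perturbation hlam hLam hFelliptic hF0 hgamma hc d0.
(* Both constants are fixed before [u] and [x0] are introduced, which is their universality. *)
exists e => //; exists d => // u bu [_ _ [cu _] [_ usub] _] x0 [Nx0 Om'x0].
move=> r /andP[r0 rd].
have cl0 := subset_closure Om'x0.
have near_x0 y : enorm (y - x0) <= d -> `|y - x0| <= d.
  exact: le_trans (norm_le_enorm _).
pose S := [set u x - phi x | x in eball x0 r].
(* Without an upper bound on [S], its [sup] would be a default value. Boundedness of [u] and the
   local bound on [phi] supply one. *)
have ubS : has_ubound S.
  have [M [_ MP]] := bu; exists (M + 1 + d^-1) => _ [y yr <-].
  have [Oy phiy _ _] := dP _ cl0 _ (near_x0 y (ltW (lt_trans yr rd))).
  have uy : `|u y| <= M + 1.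
    by apply: MP; [rewrite ltrDl|exact: subset_closure].
  by rewrite (le_trans (ler_norm _))// (le_trans (ler_normB _ _))// lerD.
rewrite leNgt; apply/negP => Sr.
have S0 : 0 < sup S.
  apply: lt_le_trans (_ : u x0 - phi x0 <= _).
    by rewrite subr_gt0; case: Nx0.
  by apply: (ub_le_sup ubS); exists x0 => //; rewrite /eball/= subrr enorm0.
(* The growth estimate gives a point of a closed ball, whereas [sup S] is over an open one. If
   [sup S < e * r ^+ 2], the midpoint [s ^+ 2] lies strictly between [sup S / e] and [r ^+ 2], so
   radius [s] stays in the open ball and still yields a contradiction. *)
pose s := Num.sqrt ((sup S / e + r ^+ 2) / 2).
have Se : sup S / e < r ^+ 2 by rewrite ltr_pdivrMr// mulrC.
have Se0 : 0 < sup S / e by rewrite divr_gt0.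
have s2 : s ^+ 2 = (sup S / e + r ^+ 2) / 2.
  by rewrite sqr_sqrtr// divr_ge0// addr_ge0 ?sqr_ge0// ltW.
have s0 : 0 < s by rewrite sqrtr_gt0 divr_gt0// addr_gt0// exprn_gt0.
have sr : s < r.
  rewrite -(@ltr_pXn2r _ 2) ?nnegrE ?ltW// s2; lra.
have [||y ys le] :=
    @quadratic_growth _ _ gamma F Om phi u e s x0 oO hphi _ usub Nx0 e0 s0.
- by rewrite -continuous_open_subspace.
- move=> y ys; have yd : enorm (y - x0) <= d.
    by rewrite (le_trans ys)// ltW// (lt_trans sr).
  have [Oy _ gy hy] := dP _ cl0 _ (near_x0 y yd).
  split=> //; apply: eP => //; first exact: hessian_sym oO hphi Oy.
  exact: hobstacle.
have yS : u y - phi y <= sup S.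
  by apply: (ub_le_sup ubS); exists y => //; exact: le_lt_trans ys sr.
have := le_trans le yS; rewrite s2 => h.
have : (sup S / e + r ^+ 2) / 2 <= sup S / e by rewrite ler_pdivlMr// mulrC.
lra.
Qed.
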